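(* Let $p$ be a prime and let $A$ be a perfect coherent ring of characteristic $p>0$. Suppose that $\bigcap_{n>0}I^{n}=0$ for every finitely generated proper ideal $I$ of $A$. Then every finitely generated ideal of $A$ is tightly closed.
   Context: All rings are commutative with unit (not assumed Noetherian). A ring is coherent if every finitely generated ideal is finitely presented. A ring $A$ of characteristic $p>0$ is perfect if the Frobenius map $a\mapsto a^p$ is bijective on $A$. Let $A^{0}$ be the complement in $A$ of the union of all minimal primes of $A$. For an ideal $I$ and $q=p^e$, $I^{[q]}$ is the ideal generated by the $q$-th powers of all elements of $I$. The tight closure $I^{*}$ of $I$ is the set of $x\in A$ for which there is $c\in A^{0}$ with $cx^{q}\in I^{[q]}$ for all $q=p^{e}\gg0$. The ideal $I$ is tightly closed if $I=I^{*}$. *)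

(* Defs.v *)
From HB Require Import structures.
From mathcomp Require Import all_boot all_order all_algebra.
From mathcomp Require Import all_classical.

Set Implicit Arguments.
Unset Strict Implicit.
Unset Printing Implicit Defensive.

Import GRing.Theory.
Local Open Scope classical_set_scope.
Local Open Scope ring_scope.

Section Ideals.
Variable A : comNzRingType.
Implicit Types (I J P Q S : set A).

(* The [idealr_closed] of MathComp is not used here: it only describes proper
   ideals, and ideals are allowed to be the whole ring below. *)
Definition is_ideal I : Prop :=
  [/\ I 0, forall x y, I x -> I y -> I (x + y) & forall a x, I x -> I (a * x)].

Definition ideal_gen S : set A := smallest is_ideal S.

Definition finitely_generated I : Prop :=
  exists2 S, finite_set S & I = ideal_gen S.

(* There is an exact sequence A^m -> A^n -> I -> 0 of A-modules; the map
   A^n -> I is given by its composite with the inclusion of I into A. *)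
Definition finitely_presented I : Prop :=
  exists (m n : nat) (f : {linear 'rV[A]_m -> 'rV[A]_n})
         (g : {linear 'rV[A]_n -> A^o}),
    range g = I /\ g @^-1` [set 0] = range f.

Definition ideal_mul I J : set A :=
  ideal_gen [set x * y | x in I & y in J].

Definition ideal_exp I (n : nat) : set A := iter n (ideal_mul I) setT.

Definition prime_ideal P : Prop :=
  [/\ is_ideal P, P <> setT & forall x y, P (x * y) -> P x \/ P y].

Definition minimal_prime P : Prop :=
  prime_ideal P /\ forall Q, prime_ideal Q -> Q `<=` P -> Q = P.

(* The set written A^0. *)
Definition off_minimal_primes : set A := ~` \bigcup_(P in minimal_prime) P.

(* The ideal written I^[q]. *)
Definition frobenius_power I (q : nat) : set A :=
  ideal_gen [set x ^+ q | x in I].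

(* Meaningful when A has characteristic p. *)
Definition tight_closure (p : nat) I : set A :=
  [set x | exists2 c, off_minimal_primes c &
     exists e0 : nat, forall e : nat, (e0 <= e)%N ->
       frobenius_power I (p ^ e) (c * x ^+ (p ^ e))].

Definition tightly_closed (p : nat) I : Prop := I = tight_closure p I.

End Ideals.

Definition coherent (A : comNzRingType) : Prop :=
  forall I : set A, finitely_generated I -> finitely_presented I.

Definition perfect (A : comNzRingType) (p : nat) (charAp : p \in [pchar A]) : Prop :=
  bijective (pFrobenius_aut charAp).

(* Main.v *)
Require Import Defs.
From HB Require Import structures.
From mathcomp Require Import all_boot all_order all_algebra.
From mathcomp Require Import all_classical.

(** Let [I] be finitely generated and [x] in the tight closure of [I], so that
    [c * x ^+ q] lies in the Frobenius power [I^[q]] for all large [q = p ^ e],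
    with [c] outside every minimal prime. Since Frobenius is bijective, the
    ideal [I^[q]] is just the set of [q]-th powers of elements of [I]
    ([frobenius_power_root]), so extracting [q]-th roots gives [d * x \in I]
    for the root [d] of [c]: every [q]-th root of [c] lies in the colon ideal
    [J = (I : x)], whence [c = d ^+ q] lies in [J ^ q] for all large [q], and
    so in every power of [J].

    Coherence makes [J] finitely generated ([coherent_colon_fg]). If [J] were
    proper, separatedness would force [c = 0]; but a nonzero ring has a minimal
    prime ([minimal_prime_exists]), which contains [0]. Hence [J] is the whole
    ring, that is, [x] lies in [I]. *)

Set Implicit Arguments.
Unset Strict Implicit.
Unset Printing Implicit Defensive.

Import GRing.Theory.
Local Open Scope classical_set_scope.
Local Open Scope ring_scope.

(** * Ideals and their powers *)

Lemma ideal_gen_ideal (A : comNzRingType) (S : set A) : is_ideal (ideal_gen S).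
Proof.
split=> [X [[]]//|x y Sx Sy X XS|a x Sx X XS].
  by case: (XS) => -[_ XD _] _; exact: XD (Sx _ XS) (Sy _ XS).
by case: (XS) => -[_ _ XM] _; exact: XM (Sx _ XS).
Qed.

Lemma ideal_sub (A : comNzRingType) (I : set A) (x y : A) :
  is_ideal I -> I x -> I y -> I (x - y).
Proof.
by case=> _ ID IM Ix Iy; apply: ID => //; rewrite -mulN1r; exact: IM.
Qed.

Lemma ideal_sum (A : comNzRingType) (I : set A) (T : Type) (r : seq T)
    (P : pred T) (F : T -> A) :
  is_ideal I -> (forall i, P i -> I (F i)) -> I (\sum_(i <- r | P i) F i).
Proof. by case=> I0 ID _ IF; exact: big_ind. Qed.

Definition colon (A : comNzRingType) (I : set A) (x : A) : set A :=
  [set a | I (a * x)].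

Lemma colon_ideal (A : comNzRingType) (I : set A) (x : A) :
  is_ideal I -> is_ideal (colon I x).
Proof.
case=> I0 ID IM; split; rewrite /colon /=.
- by rewrite mul0r.
- by move=> a b Ia Ib; rewrite mulrDl; exact: ID.
- by move=> a b Ib; rewrite -mulrA; exact: IM.
Qed.

Lemma ideal_exp_ideal (A : comNzRingType) (I : set A) (n : nat) :
  is_ideal (ideal_exp I n).
Proof. by case: n => [|n]; [split | exact: ideal_gen_ideal]. Qed.

Lemma ideal_exp_expr (A : comNzRingType) (I : set A) (x : A) (n : nat) :
  I x -> ideal_exp I n (x ^+ n).
Proof.
move=> Ix; elim: n => [//|n IHn]; rewrite exprS.
by apply: sub_gen_smallest; exists x => //; exists (x ^+ n).
Qed.

Lemma ideal_exp_expr_le (A : comNzRingType) (I : set A) (x : A) (m n : nat) :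
  (m <= n)%N -> I x -> ideal_exp I m (x ^+ n).
Proof.
move=> le_mn Ix; rewrite -(subnK le_mn) exprD.
case: (ideal_exp_ideal I m) => _ _ IM.
by apply: IM; exact: ideal_exp_expr.
Qed.

(** * Minimal primes *)

(** By Zorn there is a multiplicatively closed set [S] maximal among those
    avoiding [0]. For [a] outside [S], the closed set generated by [S] and [a]
    must contain [0], i.e. [s * a ^+ n = 0] for some [s] in [S]; this
    annihilation property makes the complement of [S] a prime ideal, and
    maximality of [S] is minimality of that prime. *)
Lemma minimal_prime_exists (A : comNzRingType) :
  exists P : set A, minimal_prime P.
Proof.
pose closed_off0 := [set S : set A |
  (forall x y, S x -> S y -> S (x * y)) /\ ~ S 0].
have [F FP Ftot|S [[SM S0] Smax]] := @Zorn_bigcup A closed_off0.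
  split=> [x y [X FX Xx] [Y FY Yy]|[X FX X0]]; last by case: (FP _ FX).
  have [XY|YX] := Ftot _ _ FX FY.
    by exists Y => //; case: (FP _ FY) => YM _; exact: YM (XY _ Xx) Yy.
  by exists X => //; case: (FP _ FX) => XM _; exact: XM Xx (YX _ Yy).
have SmaxE T : closed_off0 T -> S `<=` T -> T `<=` S.
  move=> TP ST; apply: contrapT => nTS.
  exact: (Smax T (conj ST nTS)).
have S1 : S 1.
  apply: (SmaxE (S `|` [set 1])); [split| |by right].
  - move=> x y [Sx|->] [Sy|->]; rewrite ?(mul1r, mulr1).
    + by left; exact: SM.
    + by left.
    + by left.
    + by right.
  - by case=> // /esym/eqP; rewrite oner_eq0.
  - by move=> x; left.
have nS a : ~ S a -> exists s n, S s /\ s * a ^+ n = 0.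
  move=> nSa; apply: contrapT => no_ann; apply: nSa.
  pose T := [set z | exists s n, S s /\ s * a ^+ n = z].
  apply: (SmaxE T); [split| |].
  - move=> _ _ [s [n [Ss <-]]] [t [m [St <-]]]; exists (s * t), (n + m)%N.
    by split; [exact: SM | rewrite exprD mulrACA].
  - exact: no_ann.
  - by move=> s Ss; exists s, 0%N; rewrite expr0 mulr1.
  - by exists 1, 1%N; rewrite mul1r expr1.
have SX s n : S s -> S (s ^+ n).
  by move=> Ss; elim: n => [|n IHn]; rewrite ?expr0 // exprS; exact: SM.
exists (~` S); split.
  split; [split=> // [x y nSx nSy Sxy|a x nSx Sax]|by move/seteqP => [_ /(_ 1 I)]|].
  - have [s [n [Ss sx0]]] := nS _ nSx; have [t [m [St ty0]]] := nS _ nSy.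
    apply: S0; have := SM _ _ (SM _ _ Ss St) (SX _ (n + m)%N Sxy).
    (* each term of the binomial expansion has a factor [x ^+ n] or
       [y ^+ m] *)
    suff -> : s * t * (x + y) ^+ (n + m) = 0 by [].
    rewrite exprDn mulr_sumr big1 // => i _.
    rewrite mulrnAr; suff -> : s * t * (x ^+ (n + m - i) * y ^+ i) = 0.
      by rewrite mul0rn.
    have [le_mi|lt_im] := leqP m i.
      by rewrite -(subnK le_mi) exprD mulrACA [_ ^+ _ * y ^+ m]mulrC
        [t * _]mulrA ty0 mul0r mulr0.
    have le_n : (n <= n + m - i)%N by rewrite -addnBA ?leq_addr // ltnW.
    by rewrite -(subnK le_n) exprD mulrACA [_ ^+ _ * x ^+ n]mulrC
      [s * _]mulrA sx0 !mul0r.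
  - have [s [n [Ss sx0]]] := nS _ nSx.
    apply: S0; have := SM _ _ Ss (SX _ n Sax).
    by rewrite exprMn mulrCA sx0 mulr0.
  - move=> x y nSxy; apply: contrapT => /not_orP[/contrapT Sx /contrapT Sy].
    by apply: nSxy; exact: SM.
move=> Q [[Q0 QD QM] QnT Qprime] QS; apply/seteqP; split=> // x nSx.
apply: contrapT => nQx; apply: nSx; apply: (SmaxE (~` Q)) => //.
  split; first by move=> a b nQa nQb /Qprime[].
  by move/(_ Q0).
by move=> s Ss Qs; exact: QS Qs Ss.
Qed.

Lemma off_minimal_primes_neq0 (A : comNzRingType) (c : A) :
  off_minimal_primes c -> c <> 0.
Proof.
move=> c_off c0; have [P Pmin] := minimal_prime_exists A.
by apply: c_off; exists P => //; rewrite c0; case: Pmin => -[[]].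
Qed.

Lemma off_minimal_primes1 (A : comNzRingType) : off_minimal_primes (1 : A).
Proof.
case=> P [[[_ _ PM] PnT _] _] P1; apply: PnT.
by apply/seteqP; split=> // a _; rewrite -[a]mulr1; exact: PM.
Qed.

(** * Colon ideals in coherent rings *)

(** Take a presentation [A^m -> A^n -> K] of [K = I + (x)], with maps [f] and
    [g], and write [g e_i = b_i x] modulo [I], so that [g w = beta w * x]
    modulo [I] for the linear form [beta] with coefficients [b_i]. Choose [u]
    with [g u = x]. Modulo [1 - beta u], which lies in [(I : x)], any [a]
    equals [beta (a u)]; and if [a] is in [(I : x)], then [a u] is in
    [g^-1(I)], which is generated by [range f] and by lifts of the generators
    of [I]. Hence [(I : x)] is generated by [1 - beta u] and the [beta]-images
    of these finitely many vectors. *)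
Lemma coherent_colon_fg (A : comNzRingType) (I : set A) (x : A) :
  coherent A -> finitely_generated I -> finitely_generated (colon I x).
Proof.
move=> A_coh [S Sfin I_def].
have I_ideal : is_ideal I by rewrite I_def; exact: ideal_gen_ideal.
have [I0 ID IM] := I_ideal.
pose K := ideal_gen (S `|` [set x]).
have K_ideal : is_ideal K by exact: ideal_gen_ideal.
have [|m [n [f [g [gK kerg]]]]] := A_coh K.
  by exists (S `|` [set x]) => //; rewrite finite_setU.
have gZ a w : g (a *: w) = a * g w by exact: linearZ.
have gf v : g (f v) = 0.
  have : range f (f v) by exists v.
  by rewrite -kerg.
have Kgen y : (S `|` [set x]) y -> K y by exact: sub_gen_smallest.
have /choice[h gh] : forall y, exists w, K y -> g w = y.
  move=> y; have [Ky|nKy] := pselect (K y); last by exists 0.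
  by move: Ky; rewrite -gK => -[w _ <-]; exists w.
have Kmod : K `<=` [set y | exists b, I (y - b * x)].
  apply: smallest_sub => [|z [Sz|->]].
  - split=> [|y1 y2 [b1 Ib1] [b2 Ib2]|a y1 [b1 Ib1]].
    + by exists 0; rewrite mul0r subr0.
    + by exists (b1 + b2); rewrite mulrDl opprD addrACA; exact: ID.
    + by exists (a * b1); rewrite -mulrA -mulrBr; exact: IM.
  - by exists 0; rewrite mul0r subr0 I_def; exact: sub_gen_smallest.
  - by exists 1; rewrite mul1r subrr.
have /choice[b gb] : forall i : 'I_n, exists b, I (g 'e_i - b * x).
  by move=> i; apply: Kmod; rewrite -gK; exists 'e_i.
pose beta (w : 'rV[A]_n) := \sum_i w 0 i * b i.
have betaD v w : beta (v + w) = beta v + beta w.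
  by rewrite -big_split; apply: eq_bigr => i _; rewrite mxE mulrDl.
have betaZ a w : beta (a *: w) = a * beta w.
  by rewrite mulr_sumr; apply: eq_bigr => i _; rewrite mxE mulrA.
have gbeta w : I (g w - beta w * x).
  rewrite {1}[w]row_sum_delta linear_sum mulr_suml -sumrB.
  apply: ideal_sum => // i _; rewrite gZ -mulrA -mulrBr.
  exact: IM.
have beta_colon w : I (g w) -> I (beta w * x).
  by move=> Igw; rewrite -[beta w * x](subKr (g w)); exact: ideal_sub.
have gu : g (h x) = x by apply: gh; apply: Kgen; right.
pose T := [set 1 - beta (h x)] `|` [set beta (f 'e_i) | i in [set: 'I_m]]
  `|` [set beta (h y) | y in S].
exists T.
  rewrite !finite_setU; split; [split|]; first exact: finite_set1.
    by apply: finite_image; exact: finite_finset.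
  exact: finite_image.
have TT := @sub_gen_smallest _ (@is_ideal A) T.
have T_ideal := ideal_gen_ideal T; have [T0 TD TM] := T_ideal.
apply/seteqP; split; last first.
  apply: smallest_sub; first exact: colon_ideal.
  move=> _ [[->|[i _ <-]]|[y Sy <-]]; rewrite /colon /=.
  - by rewrite mulrBl mul1r -{1}gu; exact: gbeta.
  - by apply: beta_colon; rewrite gf.
  - apply: beta_colon; rewrite gh; last by apply: Kgen; left.
    by rewrite I_def; exact: sub_gen_smallest.
have betaf v : ideal_gen T (beta (f v)).
  have -> : beta (f v) = \sum_i v 0 i * beta (f 'e_i).
    have beta0 : beta 0 = 0 by rewrite -(scale0r 0) betaZ mul0r.
    rewrite {1}[v]row_sum_delta linear_sum (big_morph beta betaD beta0).
    by apply: eq_bigr => i _; rewrite linearZ betaZ.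
  apply: ideal_sum => // i _; apply: TM; apply: TT.
  by left; right; exists i.
have lift : I `<=` [set y | exists2 w, g w = y & ideal_gen T (beta w)].
  rewrite I_def; apply: smallest_sub => [|z Sz].
    split=> [|_ _ [v <- Tv] [w <- Tw]|a _ [w <- Tw]].
    - by exists (f 0); [exact: gf | exact: betaf].
    - by exists (v + w); rewrite ?linearD // betaD; exact: TD.
    - by exists (a *: w); rewrite ?gZ // betaZ; exact: TM.
  exists (h z); first by apply: gh; apply: Kgen; left.
  by apply: TT; right; exists z.
(* two lifts of the same element differ by an element of [range f] *)
have betaI w : I (g w) -> ideal_gen T (beta w).
  move=> /lift[w' gw' Tw']; rewrite -[w](subrK w') betaD.
  suff : (g @^-1` [set 0]) (w - w').
    by rewrite kerg => -[v _ <-]; exact: TD (betaf v) Tw'.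
  by rewrite /= linearB /= gw' subrr.
move=> a Iax.
have -> : a = beta (a *: h x) + a * (1 - beta (h x)).
  by rewrite betaZ mulrBr mulr1 addrC subrK.
apply: TD; first by apply: betaI; rewrite gZ gu.
by apply: TM; apply: TT; left; left.
Qed.

(** * Frobenius powers in perfect rings *)

Lemma perfect_expr_bij (p : nat) (A : comNzRingType) (charAp : p \in [pchar A])
    (e : nat) :
  perfect charAp -> bijective (fun x : A => x ^+ (p ^ e)).
Proof.
move=> A_perf; elim: e => [|e IHe]; first by exists id => x /=; rewrite expr1.
apply: (eq_bij (bij_comp IHe A_perf)) => x /=.
by rewrite pFrobenius_autE -exprM expnS.
Qed.

(** The [q]-th powers of elements of [I] already form an ideal: closed under
    addition because Frobenius is additive, and under multiplication because
    every scalar is a [q]-th power. *)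
Lemma frobenius_power_root (p : nat) (A : comNzRingType)
    (charAp : p \in [pchar A]) (I : set A) (e : nat) :
  perfect charAp -> is_ideal I ->
  frobenius_power I (p ^ e) `<=` [set z ^+ (p ^ e) | z in I].
Proof.
move=> A_perf [I0 ID IM]; have [p_pr _] := andP charAp.
have q_char : [pchar A].-nat (p ^ e)%N.
  by rewrite pnatX pnatE // charAp.
apply: smallest_sub => //.
split=> [|_ _ [z Iz <-] [t It <-]|a _ [z Iz <-]].
- by exists 0 => //; rewrite expr0n expn_eq0 -leqn0 leqNgt prime_gt0.
- by exists (z + t); [exact: ID | rewrite exprDn_pchar].
- have [r _ rK] := perfect_expr_bij e A_perf.
  by exists (r a * z); [exact: IM | rewrite exprMn rK].
Qed.

(** * Tight closure *)

Lemma sub_tight_closure (p : nat) (A : comNzRingType) (I : set A) :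
  I `<=` tight_closure p I.
Proof.
move=> x Ix; exists 1; first exact: off_minimal_primes1.
exists 0%N => e _; rewrite mul1r.
by apply: sub_gen_smallest; exists x.
Qed.

(** This is where [q]-th roots are extracted: a multiplier [c] for [x] is a
    [q]-th power of an element of [(I : x)] for every large [q]. *)
Lemma tight_multiplier_colon_exp (p : nat) (A : comNzRingType)
    (charAp : p \in [pchar A]) (I : set A) (c x : A) (e0 n : nat) :
  perfect charAp -> is_ideal I ->
  (forall e, (e0 <= e)%N -> frobenius_power I (p ^ e) (c * x ^+ (p ^ e))) ->
  ideal_exp (colon I x) n c.
Proof.
move=> A_perf I_ideal cxP; have [p_pr _] := andP charAp.
pose e := maxn e0 n.
have [z Iz cxz] := frobenius_power_root A_perf I_ideal (cxP e (leq_maxl _ _)).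
have q_bij := perfect_expr_bij e A_perf.
have [r _ rK] := q_bij.
have Jr : I (r c * x).
  suff -> : r c * x = z by [].
  by apply: (bij_inj q_bij); rewrite /= exprMn rK -cxz.
rewrite -(rK c); apply: ideal_exp_expr_le => //.
apply: leq_trans (leq_maxr e0 n) _.
by apply: ltnW; exact: ltn_expl (prime_gt1 p_pr).
Qed.

Theorem lemma4p1 (p : nat) (p_prime : prime p) (A : comNzRingType)
    (charAp : p \in [pchar A]) (A_perfect : perfect charAp)
    (A_coherent : coherent A)
    (A_separated : forall I : set A, finitely_generated I -> I <> setT ->
       \bigcap_(n in [set n : nat | (0 < n)%N]) ideal_exp I n = [set 0]) :
  forall I : set A, finitely_generated I -> tightly_closed p I.
Proof.
move=> I I_fg; apply/seteqP; split; first exact: sub_tight_closure.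
move=> x [c c_off [e0 cxP]].
have I_ideal : is_ideal I by case: I_fg => S _ ->; exact: ideal_gen_ideal.
have [J1|J_proper] := pselect (colon I x = setT).
  by have : colon I x 1 by [rewrite J1]; rewrite /colon /= mul1r.
case: (off_minimal_primes_neq0 c_off).
have /seteqP[sub0 _] :=
  A_separated _ (coherent_colon_fg x A_coherent I_fg) J_proper.
by apply: sub0 => n _; exact: tight_multiplier_colon_exp A_perfect I_ideal cxP.
Qed.
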